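(* Let $f(x)\in\mathbb{Z}[x]$ be such that $0$ is a strictly preperiodic point of the map $x\mapsto f(x)$. Let $\ell(f)=\operatorname{lcm}[f(0),f^2(0)]$. Let $x_0$ be an integer with a wandering orbit $(x_n)_{n\ge 0}$ under $f$, and define \[ a_n=\frac{x_n}{\gcd(x_n,\ell(f))}\quad\text{for all } n\ge 0. \] Then $(a_n)_{n\ge0}$ is an infinite sequence of pairwise coprime integers, and for every $n\ge 3$, $a_n$ has a private prime factor.
   Context: For a polynomial $f$, $f^n$ denotes the $n$-fold composition of $f$ with itself ($f^0$ is the identity). The orbit of $x_0$ under $f$ is the sequence $x_n=f^n(x_0)$, $n\ge0$. A point $\alpha$ is periodic if $f^n(\alpha)=\alpha$ for some $n\ge1$; preperiodic if $f^m(\alpha)$ is periodic for some $m\ge0$; strictly preperiodic if it is preperiodic but not periodic; and it has a wandering orbit if it is not preperiodic, i.e. the values $f^m(\alpha)$, $m\ge0$, are pairwise distinct. For a sequence of integers $(a_n)$, a prime $p$ is a private prime factor of $a_n$ if $p$ divides $a_n$ and divides no other term $a_m$, $m\neq n$. *)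

(* Defs.v *)
From mathcomp Require Import all_boot all_order all_algebra.

Set Implicit Arguments.
Unset Strict Implicit.
Unset Printing Implicit Defensive.

Import GRing.Theory.

Local Open Scope ring_scope.

Definition poly_iter (f : {poly int}) (n : nat) : {poly int} :=
  iter n (fun g => f \Po g) 'X.

Definition orbit_term (f : {poly int}) (x : int) (n : nat) : int :=
  (poly_iter f n).[x].

Lemma orbit_termE f x n : orbit_term f x n = iter n (horner f) x.
Proof.
rewrite /orbit_term /poly_iter.
by elim: n => [|n IHn] /=; rewrite ?hornerX // horner_comp IHn.
Qed.

Definition periodic (f : {poly int}) (x : int) : Prop :=
  exists2 n : nat, (1 <= n)%N & orbit_term f x n = x.

Definition preperiodic (f : {poly int}) (x : int) : Prop :=
  exists m : nat, periodic f (orbit_term f x m).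

Definition strictly_preperiodic (f : {poly int}) (x : int) : Prop :=
  preperiodic f x /\ ~ periodic f x.

Definition wandering (f : {poly int}) (x : int) : Prop := ~ preperiodic f x.

Definition ell (f : {poly int}) : int :=
  lcmz (orbit_term f 0 1) (orbit_term f 0 2).

(* The integer division is exact: the gcd divides its first argument. *)
Definition reduced_orbit (f : {poly int}) (x : int) (n : nat) : int :=
  (orbit_term f x n %/ gcdz (orbit_term f x n) (ell f))%Z.

Definition private_prime_factor (a : nat -> int) (n p : nat) : Prop :=
  [/\ prime p, (p%:Z %| a n)%Z
    & forall m : nat, m <> n -> ~ (p%:Z %| a m)%Z].

(* Main.v *)
(* Write u_k = f^k(0) and x_n for the orbit of x0. For n = m + k, x_n = u_k modulo
x_m, so gcd(x_m, x_n) divides u_k. Divisibility of differences forces integer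
cycles to have length at most 2, whence every u_k divides u_2 = +/- ell(f), and
dividing out gcd(x_n, ell(f)) makes the terms coprime.

Any prime factor of a_n is then private, so it remains to see that x_n does not
divide u_2 when n >= 3. Always u_4 = u_2, and (u_1, u_2, u_3) is (a, a, a),
(+/-1, b, +/-1), (a, -a, -a) with |a| <= 2, or (a, 2a, -a) with |a| = 1. In the
first two families f(0) = f(u_2) = a, so x(x - u_2) divides f(x) - a; if x_n
divides u_2, this confines x_(n-1) and x_(n-2) to a neighbourhood of {0, u_2},
which is impossible for |u_2| >= 10. The finitely many remaining cases, whose
orbit terms are bounded, are settled by computation. *)
Require Import Defs.
From mathcomp Require Import all_boot all_order all_algebra.
From mathcomp Require Import zify ring.
Import Order.TTheory GRing.Theory Num.Theory.
Local Open Scope ring_scope.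

(** * Divisibility of differences and sizes of divisors *)

Lemma dvdz_sub_horner (f : {poly int}) (s t : int) :
  (s - t %| f.[s] - f.[t])%Z.
Proof.
have /factor_theorem [q fE] : root (f - (f.[t])%:P) t.
  by rewrite rootE !hornerE subrr.
by have := congr1 (horner^~ s) fE; rewrite !hornerE => ->; rewrite dvdz_mull.
Qed.

(** The polynomial f - f(q) has the distinct roots p and q, and the two monic linear factors split
    off over the integers. *)
Lemma dvdz_mul_sub_horner (f : {poly int}) (p q s : int) :
  p != q -> f.[p] = f.[q] -> ((s - p) * (s - q) %| f.[s] - f.[q])%Z.
Proof.
move=> npq fpq.
have /factor_theorem [g fE] : root (f - (f.[q])%:P) q.
  by rewrite rootE !hornerE subrr.
have gp : g.[p] = 0.
  have := congr1 (horner^~ p) fE; rewrite !hornerE fpq subrr.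
  by move/esym/eqP; rewrite mulf_eq0 subr_eq0 (negbTE npq) orbF => /eqP.
have /factor_theorem [h gE] : root g p by rewrite rootE gp.
have := congr1 (horner^~ s) fE; rewrite gE !hornerE => ->.
by rewrite -mulrA dvdz_mull.
Qed.

(* [dvdzP] with the quotient typed plainly as [int], which [lia] requires. *)
Lemma dvdz_quotient (a b : int) : (a %| b)%Z -> exists q : int, b = q * a.
Proof. by case/dvdzP=> q ->; exists q. Qed.

Lemma dvdz_eq0 (a b : int) : (a %| b)%Z -> a = 0 -> b = 0.
Proof. by move=> ab a0; move: ab; rewrite a0 dvd0z => /eqP. Qed.

Lemma dvdz_absz_half (a b : int) : (a %| b)%Z -> b != 0 ->
  (`|a| = `|b| \/ `|a| * 2 <= `|b|)%N.
Proof.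
move=> /dvdzP[q ->]; rewrite mulf_eq0 negb_or abszM => /andP[q0 a0].
have [q1|q2] : `|q|%N = 1%N \/ (2 <= `|q|)%N by lia.
  by left; rewrite q1 mul1n.
by right; rewrite mulnC leq_mul2r q2 orbT.
Qed.

Lemma dvdz_absz_le (a b : int) : (a %| b)%Z -> b != 0 -> (`|a| <= `|b|)%N.
Proof. by move=> ab b0; case: (dvdz_absz_half _ _ ab b0) => ?; lia. Qed.

Lemma dvdz_absz_eq (a b : int) :
  (a %| b)%Z -> (b %| a)%Z -> `|a|%N = `|b|%N.
Proof. by rewrite !dvdzE => ab ba; apply/eqP; rewrite eqn_dvd ab. Qed.

(** * Cycles of integer maps that respect divisibility of differences *)

Definition difference_dvd (F : int -> int) :=
  forall s t, (s - t %| F s - F t)%Z.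

Section DifferenceDvd.

Variables (F : int -> int) (dF : difference_dvd F).

Lemma difference_dvd_iter n : difference_dvd (iter n F).
Proof.
move=> s t; elim: n => [|n IHn] //=.
exact: dvdz_trans IHn (dF _ _).
Qed.

Lemma cycle_mul n k y : iter n F y = y -> iter (n * k) F y = y.
Proof. by move=> Fy; elim: k => [|k IHk]; rewrite ?muln0 // mulnS iterD IHk. Qed.

(* The successive differences along a cycle divide each other cyclically, so
they agree up to sign; if no two consecutive ones are opposite, they are all
equal and the orbit is an arithmetic progression. *)
Lemma cycle_length_le2 n y : (0 < n)%N -> iter n F y = y -> F (F y) = y.
Proof.
move=> n0 Fy; apply/eqP/negPn/negP => nFFy.
pose d j := iter j.+1 F y - iter j F y.
have dS j : (d j %| d j.+1)%Z by exact: dF.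
have dD j k : (d j %| d (j + k)%N)%Z.
  by elim: k => [|k IHk]; rewrite ?addn0 // addnS; exact: dvdz_trans IHk (dS _).
have dper k : d (n * k)%N = d 0%N by rewrite /d /= cycle_mul.
have absd j : `|d j|%N = `|d 0|%N.
  apply: dvdz_absz_eq (dD 0 j); rewrite -(dper j).
  by rewrite -(@subnKC j (n * j)%N) ?leq_pmull // dD.
have noback j : iter j.+2 F y != iter j F y.
  apply: contra nFFy => /eqP Ej.
  (* Pushing the coincidence forward to the index [n * j], a multiple of the period, turns it into
     F(F(y)) = y. *)
  have := congr1 (iter (n * j - j)%N F) Ej.
  rewrite -!iterD !addnS subnK ?leq_pmull // /= cycle_mul //.
  by move->.
have dconst j : d j = d 0%N.
  elim: j => // j IHj; have := absd j.+1; have := noback j.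
  by move: IHj; rewrite /d /=; lia.
have arith j : iter j F y = y + d 0%N * j%:R.
  elim: j => [|j IHj]; first by rewrite mulr0 addr0.
  have := dconst j; rewrite {1}/d IHj => /eqP; rewrite subr_eq => /eqP ->.
  by rewrite -natr1; ring.
have := arith n; rewrite Fy => /eqP; rewrite -[X in X == _]addr0.
rewrite (inj_eq (addrI y)) eq_sym mulf_eq0 pnatr_eq0 (gtn_eqF n0) orbF.
rewrite /d subr_eq0 => /eqP /= Fyy.
by move: nFFy; rewrite !Fyy eqxx.
Qed.

End DifferenceDvd.

(** * Arithmetic of the orbit of zero *)

(** Excludes u_4 = -u_2, with a, b, c = u_1, u_2, u_3. Since c divides b and -b - a, it is associate
    to a, so c = -a. Then b - a and b + a divide each other, which forces a or b to vanish. *)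
Lemma third_value_absurd (a b c : int) :
  b != 0 -> (c %| b)%Z -> (a %| b)%Z -> (a %| c)%Z -> (c %| - b - a)%Z ->
  (b - a %| c - b)%Z -> (c - b %| - b - c)%Z -> c <> a -> False.
Proof.
move=> b0 cb ab ac cba bacb cbbc nca.
have ca : (c %| a)%Z.
  by rewrite -[a](subKr (- b)) rpredB ?rpredN.
have a0 : a != 0 by apply: contraNneq b0 => a0; rewrite a0 dvd0z in ab.
have absca := dvdz_absz_eq _ _ ac ca.
have cNa : c = - a by clear - absca nca; lia.
rewrite cNa in bacb cbbc.
have n1 : - a - b != 0.
  by apply/eqP => e; have := dvdz_eq0 _ _ cbbc e; clear - e a0 b0; lia.
have n2 : - b - - a != 0.
  by apply/eqP => e; have /(dvdz_eq0 _ _ bacb) : b - a = 0; clear - e a0 b0; lia.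
have := dvdz_absz_half _ _ bacb n1; have := dvdz_absz_half _ _ cbbc n2.
clear - a0 b0; lia.
Qed.

(** Write c = i a, b = j c, c - a = t b. Cancelling a gives i - 1 = i j t, so i is a unit; if i = -1
    then j t = 2. Of the four values of j, only j = 2 contradicts the last hypothesis: -3a would
    divide a. *)
Lemma zero_orbit_shapes (a b c : int) :
  a != 0 -> b != 0 -> (a %| c)%Z -> (c %| b)%Z ->
  (b %| c - a)%Z -> (b - a %| c - b)%Z ->
  [\/ c = a, b = - a /\ c = - a, b = a /\ c = - a | b = a * 2 /\ c = - a].
Proof.
move=> a0 b0 /dvdz_quotient[i cE] /dvdz_quotient[j bE] /dvdz_quotient[t tE] bacb.
have [->|nca] := eqVneq c a; first by constructor 1.
have i1 : i - 1 = i * (j * t).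
  apply/eqP; rewrite -(inj_eq (mulIf a0)); apply/eqP.
  by rewrite mulrBl mul1r -cE tE bE cE; ring.
have iN1 : i = -1.
  have : (i %| 1)%Z.
    by have := rpredB (dvdzz i) (dvdz_mulr (j * t) (dvdzz i)); rewrite -i1 subKr.
  by rewrite dvdz1 => /eqP; move/eqP: nca; rewrite cE; clear; nia.
rewrite {i}iN1 mulN1r in cE i1; rewrite cE in nca bE tE bacb *.
have jt : `|j|%N = 1%N \/ `|j|%N = 2%N.
  have jt2 : 2%:Z = t * j by clear - i1; lia.
  have : (j %| 2)%Z by rewrite jt2 dvdz_mull.
  have j0 : j != 0 by apply: contraNneq b0 => j0; rewrite bE j0 mul0r.
  by case/dvdz_absz_half=> //; clear - j0; lia.
have [|[|[|]]] : j = 1 \/ j = -1 \/ j = 2 \/ j = -2 by clear - jt; lia.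
- by move=> jE; constructor 2; rewrite bE jE mul1r.
- by move=> jE; constructor 3; rewrite bE jE; split; ring.
- move=> jE; rewrite jE in bE; exfalso.
  have := dvdz_absz_half _ _ bacb; rewrite bE; clear - a0; lia.
- by move=> jE; constructor 4; rewrite bE jE; split; ring.
Qed.

(* The possible values of f(0), f^2(0), f^3(0); always f^4(0) = f^2(0). *)
Definition zero_orbit_type (a b c : int) : Prop :=
  [\/ c = a /\ (a = b \/ `|a|%N = 1%N),
      [/\ b = - a, c = - a & (`|a| <= 2)%N]
    | [/\ b = a * 2, c = - a & `|a|%N = 1%N]].

Section ZeroOrbit.

Variables (F : int -> int) (dF : difference_dvd F).

Let u k := iter k F 0.

Hypothesis u_neq0 : forall k, (0 < k)%N -> u k != 0.

Hypothesis u_preper : exists m n, (0 < n)%N /\ iter n F (u m) = u m.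

(** Induction on j: applying F^(kj) to u_k and 0 shows that u_k divides u_(kj+k) - u_(kj). *)
Lemma zero_orbit_dvd_mul k j : (u k %| u (k * j)%N)%Z.
Proof.
elim: j => [|j IHj]; first by rewrite muln0 dvdz0.
have := difference_dvd_iter _ dF (k * j)%N (u k) 0.
rewrite subr0 {2}/u -iterD addnC -mulnS -/(u _) -/(u _) => dk.
by rewrite -[u _](subrK (u (k * j)%N)) rpredD.
Qed.

Lemma zero_orbit_period2 :
  exists2 m, (0 < m)%N & forall i j, (m <= j)%N -> u (j + i * 2)%N = u j.
Proof.
have [m [n [n0 /(cycle_length_le2 _ dF _ _ n0) Fum]]] := u_preper.
exists m.+1 => // i j mj; elim: i => [|i IHi]; first by rewrite addn0.
rewrite -[RHS]IHi (_ : (j + i.+1 * 2 = (j - m + i * 2) + m.+2)%N); last by lia.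
have -> : (j + i * 2 = (j - m + i * 2) + m)%N by lia.
by rewrite /u !iterD /= Fum.
Qed.

(* The eventual value E of the even-index terms is fixed by F^2, so E divides
F^2(E) - F^2(0) = E - u 2. *)
Lemma zero_orbit_dvd_u2 k : (0 < k)%N -> (u k %| u 2)%Z.
Proof.
move=> k0; have [m m0 uper] := zero_orbit_period2.
pose E := u (m * 2)%N.
have uE : (u k %| E)%Z.
  have <- : u (k * (m * 2))%N = E.
    have -> : (k * (m * 2) = m * 2 + (k.-1 * m) * 2)%N by case: k k0 => // k _; lia.
    by rewrite uper //; lia.
  exact: zero_orbit_dvd_mul.
apply: dvdz_trans uE _.
have := difference_dvd_iter _ dF 2 E 0.
have -> : iter 2 F E = E by rewrite -[RHS](uper 1%N) /E ?addn2 //; lia.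
by rewrite subr0 -/(u 2) => dE; rewrite -[u 2](subKr E) rpredB.
Qed.

(** u_2 and u_4 divide each other, so the only alternative is u_4 = -u_2. *)
Lemma zero_orbit_u4 : u 4 = u 2.
Proof.
have u20 := u_neq0 2%N isT.
have abs_even k : (0 < k)%N -> `|u (k * 2)|%N = `|u 2|%N.
  move=> k0; apply: dvdz_absz_eq; first by apply: zero_orbit_dvd_u2; lia.
  by rewrite mulnC zero_orbit_dvd_mul.
apply/eqP/negPn/negP => u42.
have abs4 : `|u 4|%N = `|u 2|%N by exact: abs_even 2%N isT.
have u4N : u 4 = - u 2 by lia.
have u6N : u 6 = - u 2.
  have abs6 : `|u 6|%N = `|u 2|%N by exact: abs_even 3%N isT.
  have [//|u62] : u 6 = - u 2 \/ u 6 = u 2 by lia.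
  have /(cycle_length_le2 _ dF) : iter 4 F (u 2) = u 2 by [].
  by move=> /(_ isT); rewrite -/(u 4) => /eqP; rewrite (negbTE u42).
apply: (third_value_absurd (u 1) (u 2) (u 3)) => //.
- exact: zero_orbit_dvd_u2.
- exact: zero_orbit_dvd_u2.
- exact: (zero_orbit_dvd_mul 1 3).
- by rewrite -u4N; have := dF (u 3) 0; rewrite subr0.
- exact: (dF (u 2) (u 1)).
- by have := dF (u 3) (u 2); rewrite -[F (u 3)]/(u 4) u4N.
- by move=> u31; case/eqP: u42; rewrite -[u 4]/(F (u 3)) u31.
Qed.

Hypothesis d2F : forall p q s,
  p != q -> F p = F q -> ((s - p) * (s - q) %| F s - F q)%Z.

(** [d2F] sharpens the shapes wherever two points share an image. If c = a, then 0 and b do, so a(a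
    - b) divides b - a. In the two surviving shapes with c = -a, the points a and -a do; evaluating
    at 0, a^2 divides 2a or a. *)
Lemma zero_orbit_classification : zero_orbit_type (u 1) (u 2) (u 3).
Proof.
have u20 := u_neq0 2%N isT; have u10 := u_neq0 1%N isT.
have Fa : F (u 1) = u 2 by []; have Fb : F (u 2) = u 3 by [].
have Fc : F (u 3) = u 2 by exact: zero_orbit_u4.
have F0 : F 0 = u 1 by [].
have a_c : (u 1 %| u 3)%Z by exact: (zero_orbit_dvd_mul 1 3).
have c_b : (u 3 %| u 2)%Z by exact: zero_orbit_dvd_u2.
have b_ca : (u 2 %| u 3 - u 1)%Z by have := dF (u 2) 0; rewrite subr0.
have ba_cb : (u 2 - u 1 %| u 3 - u 2)%Z by exact: (dF (u 2) (u 1)).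
move: Fa Fb Fc F0 u10 u20 a_c c_b b_ca ba_cb.
move: (u 1) (u 2) (u 3) => a b c Fa Fb Fc F0 a0 b0 a_c c_b b_ca ba_cb.
have na : a != - a by clear - a0; lia.
have [ca|[bE cE]|[bE cE]|[bE cE]] :=
    zero_orbit_shapes _ _ _ a0 b0 a_c c_b b_ca ba_cb.
- constructor 1; split=> //; have [<-|nab] := eqVneq a b; first by left.
  right; have := d2F 0 b a; rewrite eq_sym F0 Fa Fb ca => /(_ b0 erefl).
  rewrite subr0 -[X in (_ %| X)%Z]opprB -[X in (_ %| - X)%Z]mul1r rpredN.
  by rewrite dvdz_mul2r ?subr_eq0 // dvdz1 => /eqP.
- constructor 2; split=> //; have := d2F a (- a) 0.
  rewrite F0 Fa -bE Fb cE bE => /(_ na erefl).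
  rewrite (_ : (0 - a) * _ = (- a) * a); last by ring.
  rewrite (_ : a - - a = 2 * a); last by ring.
  rewrite dvdz_mul2r // => /dvdz_absz_le; rewrite abszN; exact.
(* With b = a, also c = F(b) = F(a) = b = a, against c = -a. *)
- by case/eqP: na; rewrite -cE -Fb bE Fa.
- constructor 3; split=> //; have := d2F a (- a) 0.
  rewrite F0 Fa -cE Fc cE => /(_ na erefl).
  rewrite (_ : (0 - a) * _ = (- a) * a); last by ring.
  rewrite bE (_ : a - a * 2 = (- 1) * a); last by ring.
  by rewrite dvdz_mul2r // dvdzE !abszN dvdn1 => /eqP.
Qed.

End ZeroOrbit.

(** * Chains ending at a divisor of u_2: finite search *)

(** Computable necessary conditions for y = f(x): compare x with 0, a, b, c, whose images are a, b,
    c, b. When c = a, the points 0 and b share the image a, whence the product. *)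
Definition orbit_step (a b c x y : int) : bool :=
  [&& (x %| y - a)%Z, (x - a %| y - b)%Z, (x - b %| y - c)%Z,
      (x - c %| y - b)%Z & (c == a) ==> (x * (x - b) %| y - a)%Z].

Definition zero_orbit_typeb (a b c : int) : bool :=
  [|| (c == a) && ((a == b) || (`|a| == 1)%N),
      [&& b == - a, c == - a & (`|a| <= 2)%N]
    | [&& b == a * 2, c == - a & (`|a| == 1)%N]].

Definition int_range (n : nat) : seq int := [seq i%:Z - n%:Z | i <- iota 0 n.*2.+1].

Lemma mem_int_range n (x : int) : (`|x| <= n)%N -> x \in int_range n.
Proof.
move=> xn; apply/mapP; exists (absz (x + n%:Z)); last by lia.
by rewrite mem_iota; lia.
Qed.

(* The bound 27 comes from |x - b| <= |y - c| <= |z - b| <= |w - c| <= 9 + 9.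
Filters rather than [==>], whose two sides [vm_compute] evaluates eagerly. *)
Definition no_short_chain (a b c : int) : bool :=
  all (fun w => all (fun z => all (fun y =>
    ~~ has (fun x => (x \notin [:: 0; a; b; c; w; z; y]) && orbit_step a b c x y)
      (int_range 27))
    [seq y <- int_range 27 | (y \notin [:: 0; a; b; c; w; z]) && orbit_step a b c y z])
    [seq z <- int_range 27 | (z \notin [:: 0; a; b; c; w]) && orbit_step a b c z w])
    [seq w <- int_range 9 | (w \notin [:: 0; a; b; c]) && (w %| b)%Z].

(** One range serves both a and b, because |a| <= |b| in every type; the argument for large |b|
    starts at 10. *)
Lemma no_short_chain_small :
  all (fun b => all (fun a => all (fun c => no_short_chain a b c)
    [seq c <- [:: a; - a] | [&& zero_orbit_typeb a b c, a != 0 & b != 0]])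
    (int_range 9)) (int_range 9).
Proof. by vm_compute. Qed.

(** * Chains ending at a divisor of u_2: large |b| *)

Lemma absz_le2 (i : int) :
  (0 < `|i| <= 2)%N -> [\/ i = 1, i = 2, i = -1 | i = -2].
Proof.
move=> i2; have [|[|[|]]] : i = 1 \/ i = 2 \/ i = -1 \/ i = -2 by lia.
- by constructor 1.
- by constructor 2.
- by constructor 3.
- by constructor 4.
Qed.

(** If |z| and |z - b| were both at least 3, their product would be at least 3(|b| - 3), which
    exceeds 2|b| exactly when |b| >= 10. The product is always at least |b| - 1, which bounds q. The
    substitution z -> b - z preserves z(z - b), so s stands for whichever of z, b - z is small. *)
Lemma small_multiple_of_mul_sub (b z v : int) : (10 <= `|b|)%N ->
  z != 0 -> z != b -> v != 0 -> (`|v| <= `|b| * 2)%N -> (z * (z - b) %| v)%Z ->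
  exists q s : int, [/\ v = q * (s * (s - b)), (0 < `|q| <= 2)%N,
    (0 < `|s| <= 2)%N & z = s \/ z = b - s].
Proof.
move=> b10 z0 zb v0 vb /dvdz_quotient[q vE].
have q0 : q != 0 by apply: contraNneq v0 => q0; rewrite vE q0 mul0r.
have absv : (`|q| * (`|z| * `|z - b|) <= `|b| * 2)%N by rewrite -!abszM -vE.
have zb1 : (`|b| <= `|z| + `|(z - b)%R|)%N by clear; lia.
have z1 : (1 <= `|z|)%N by clear - z0; lia.
have zb2 : (1 <= `|(z - b)%R|)%N by clear - zb; lia.
have q1 : (1 <= `|q|)%N by clear - q0; lia.
have near : (`|z| <= 2)%N \/ (`|(z - b)%R| <= 2)%N.
  have le : (`|z| * `|z - b| <= `|b| * 2)%N by apply: leq_trans absv; rewrite leq_pmull.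
  have [zs|z3] := leqP `|z|%N 2%N; first by left.
  have [zbs|zb3] := leqP `|(z - b)%R|%N 2%N; first by right.
  exfalso; move: (`|z|%N) (`|(z - b)%R|%N) z3 zb3 le zb1 => m n m3 n3 le zb1.
  move: le zb1; rewrite -(subnKC m3) -(subnKC n3) mulnDl !mulnDr.
  by move: (m - 3)%N (n - 3)%N => i j; clear - b10; lia.
have q2 : (`|q| <= 2)%N.
  have ge : (`|b| - 1 <= `|z| * `|(z - b)%R|)%N.
    move: zb1; rewrite -(subnKC z1) -(subnKC zb2) mulnDl !mulnDr.
    by move: (`|z| - 1)%N (`|(z - b)%R| - 1)%N => i j; clear; lia.
  rewrite leqNgt; apply/negP => q3; have := leq_trans (leq_mul q3 ge) absv.
  by clear - b10; lia.
case: near => zs.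
  by exists q, z; split; rewrite ?q1 ?z1 //; left.
exists q, (b - z); split.
- by rewrite vE; ring.
- by rewrite q1.
- by clear - zb zs; lia.
- by right; ring.
Qed.

Lemma no_short_chain_large (a b y z w : int) : (10 <= `|b|)%N ->
  a = b \/ `|a|%N = 1%N ->
  w != 0 -> w != a -> w != b -> (w %| b)%Z ->
  z != 0 -> z != a -> z != b -> z != w -> (z * (z - b) %| w - a)%Z ->
  y != 0 -> y != b -> (y * (y - b) %| z - a)%Z -> False.
Proof.
move=> b10 aE w0 wa wb w_b z0 za zb zw z_w y0 yb y_z.
have b0 : b != 0 by clear - b10; lia.
have wbound := dvdz_absz_half _ _ w_b b0.
have [q [s [wE q2 s2 zs]]] : exists q s : int,
    [/\ w - a = q * (s * (s - b)), (0 < `|q| <= 2)%N,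
        (0 < `|s| <= 2)%N & z = s \/ z = b - s].
  apply: small_multiple_of_mul_sub => //; first by rewrite subr_eq0.
  by clear - b10 aE wbound; lia.
have [p [t [zE p2 t2 yt]]] : exists q s : int,
    [/\ z - a = q * (s * (s - b)), (0 < `|q| <= 2)%N,
        (0 < `|s| <= 2)%N & y = s \/ y = b - s].
  apply: small_multiple_of_mul_sub => //; first by rewrite subr_eq0.
  by clear - b10 aE s2 zs; lia.
clear w_b z_w y_z.
have bsgn : b <= -10 \/ 10 <= b by clear - b10; lia.
have {}wbound : [\/ w = - b, - b <= w * 2 <= b | b <= w * 2 <= - b].
  have [wNb|nwNb] := eqVneq w (- b); first by constructor 1.
  case: bsgn => bs; [constructor 3|constructor 2]; clear - wbound wb nwNb bs; lia.
have {}aE : [\/ a = b, a = 1 | a = -1].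
  case: aE => [->|a1]; first by constructor 1.
  by case: (intP a) a1 => // -[] // _; [constructor 2|constructor 3].
(* In w = a + q s^2 - q s b the multiple of b dominates; as w is -b or at most |b|/2 in size, q s =
   1. *)
have {wbound} [sE q1 az] : [/\ s = q, `|q|%N = 1%N & a = b /\ w = s \/ a = - s].
  have [] := absz_le2 q q2 => qE; have [] := absz_le2 s s2 => sE;
  rewrite {}qE {}sE in wE *;
  case: aE => aE; rewrite aE in wa wE *; case: bsgn => bs; case: wbound => wE';
  try (exfalso; clear - bs wE wb wE'; lia);
  split=> //; by [right | left; split=> //; clear - wE; lia].
have sE1 : s = 1 \/ s = -1 by clear - sE q1; lia.
have z_a : [\/ z - a = - s, z - a = s * 2 | z - a = b].
  case: az => [[ab ws]|as_]; case: zs => zs.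
  - by case/eqP: zw; rewrite zs ws.
  - by constructor 1; rewrite zs ab; ring.
  - by constructor 2; rewrite zs as_; ring.
  - by constructor 3; rewrite zs as_; ring.
rewrite zE in z_a.
(* p t (t - b) has size at least |b| - 1 >= 9, so it is neither -s nor 2s; it is not b either, since
   0 < |p t^2| <= 8 is no multiple of b. *)
have [] := absz_le2 p p2 => pE; have [] := absz_le2 t t2 => tE;
  rewrite {}pE {}tE in z_a;
  case: z_a => z_a; clear - bsgn sE1 z_a; lia.
Qed.

Lemma no_chain_into_divisor (a b c x y z w : int) :
  zero_orbit_type a b c -> a != 0 -> b != 0 -> (w %| b)%Z ->
  w \notin [:: 0; a; b; c] -> z \notin [:: 0; a; b; c; w] ->
  y \notin [:: 0; a; b; c; w; z] -> x \notin [:: 0; a; b; c; w; z; y] ->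
  orbit_step a b c z w -> orbit_step a b c y z -> orbit_step a b c x y -> False.
Proof.
move=> abc a0 b0 w_b w_out z_out y_out x_out zw yz xy.
have [b9|b10] := leqP `|b| 9.
  have ca : c = a \/ c = - a by case: abc => [[-> _]|[_ -> _]|[_ -> _]]; [left|right|right].
  have absab : (`|a| <= `|b|)%N.
    case: abc => [[_ [->//|->]]|[-> _ _]|[-> _ _]]; first by rewrite absz_gt0.
      by rewrite abszN.
    by rewrite abszM leq_pmulr.
  have wb := dvdz_absz_le _ _ w_b b0.
  have [wc zc yc] : [/\ w - c != 0, z - b != 0 & y - c != 0].
    move: w_out z_out y_out; rewrite !subr_eq0 !inE !negb_or.
    by do 3!move=> /and5P[_ _ ? ? _] || move=> /and4P[_ _ _ ?].
  have zb_wc : (`|(z - b)%R| <= `|(w - c)%R|)%N.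
    by case/and5P: zw => _ _ /dvdz_absz_le -> //.
  have yc_zb : (`|(y - c)%R| <= `|(z - b)%R|)%N.
    by case/and5P: yz => _ _ _ /dvdz_absz_le -> //.
  have xb_yc : (`|(x - b)%R| <= `|(y - c)%R|)%N.
    by case/and5P: xy => _ _ /dvdz_absz_le -> //.
  have typeb : zero_orbit_typeb a b c.
    rewrite /zero_orbit_typeb; case: abc => [[-> [->|->]]|[-> -> ->]|[-> -> ->]];
    by rewrite !eqxx ?orbT.
  have /allP/(_ b (mem_int_range _ _ b9)) := no_short_chain_small.
  move/allP/(_ a (mem_int_range _ _ (leq_trans absab b9))).
  move/allP/(_ c); rewrite mem_filter typeb a0 b0 !inE.
  rewrite (_ : (c == a) || (c == - a)); last by case: ca => ->; rewrite eqxx ?orbT.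
  move=> /(_ isT)/allP/(_ w); rewrite mem_filter w_out w_b.
  rewrite mem_int_range ?(leq_trans wb b9) //.
  move=> /(_ isT)/allP/(_ z); rewrite mem_filter z_out zw mem_int_range; last first.
    by clear - zb_wc wb b9 absab ca; lia.
  move=> /(_ isT)/allP/(_ y); rewrite mem_filter y_out yz mem_int_range; last first.
    by clear - yc_zb zb_wc wb b9 absab ca; lia.
  move=> /(_ isT)/negP; apply; apply/hasP; exists x; last by rewrite x_out xy.
  by apply: mem_int_range; clear - xb_yc yc_zb zb_wc wb b9 absab ca; lia.
(* The other two types have |b| <= 2. *)
have [ca ab] : c = a /\ (a = b \/ `|a|%N = 1%N).
  case: abc b10 => [//|[-> _]|[-> _]]; clear; lia.
subst c; case/and5P: zw => _ _ _ _; case/and5P: yz => _ _ _ _.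
rewrite eqxx /= => y_z z_w.
move: w_out z_out y_out; rewrite !inE !negb_or.
case/and4P=> w0 wa wb _; case/and5P=> z0 za zb _ zw.
case/and5P=> y0 _ yb _ _.
exact: (no_short_chain_large a b y z w).
Qed.

(** * Wandering orbits and reduction by gcds *)

(** A meeting would carry the cycle reached from 0 over to the orbit of x. *)
Lemma not_wandering_meets_zero (f : {poly int}) (x : int) (i k : nat) :
  preperiodic f 0 -> wandering f x -> orbit_term f x i <> orbit_term f 0 k.
Proof.
move=> [m [n n0]]; rewrite !orbit_termE => per0 wx xi; apply: wx.
have xE : iter (m + i) (horner f) x = iter k (horner f) (iter m (horner f) 0).
  by rewrite iterD xi -!iterD addnC.
exists (m + i)%N, n => //.
by rewrite !orbit_termE xE -iterD addnC iterD per0.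
Qed.

Lemma wandering_inj (f : {poly int}) (x : int) :
  wandering f x -> injective (orbit_term f x).
Proof.
move=> wx; suff lt i j : (i < j)%N -> orbit_term f x i <> orbit_term f x j.
  by move=> i j ij; case: (ltngtP i j) => // /lt; rewrite ij.
move=> ij xij; apply: wx; exists i, (j - i)%N; first by rewrite subn_gt0.
by rewrite [RHS]xij !orbit_termE -iterD subnK // ltnW.
Qed.

(** With d = gcd(m, n), d divides both gcd(m, l) and gcd(n, l), so the two quotients divide m/d and
    n/d, which are coprime. *)
Lemma coprime_div_gcd (m n l : nat) : (0 < m)%N -> (gcdn m n %| l)%N ->
  coprime (m %/ gcdn m l) (n %/ gcdn n l).
Proof.
move=> m0 dl; have d0 : (0 < gcdn m n)%N by rewrite gcdn_gt0 m0.
have red k : (gcdn m n %| k)%N -> (k %/ gcdn k l %| k %/ gcdn m n)%N.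
  move=> dk; rewrite dvdn_divRL // mulnC.
  have /dvdnP[q gE] : (gcdn m n %| gcdn k l)%N by rewrite dvdn_gcd dk.
  rewrite -[X in (_ %| X)%N](@divnK (gcdn k l)) ?dvdn_gcdl // mulnC.
  by rewrite dvdn_mul // gE dvdn_mull.
apply: coprime_dvdl (red m (dvdn_gcdl _ _)) _.
apply: coprime_dvdr (red n (dvdn_gcdr _ _)) _.
rewrite /coprime -(eqn_pmul2r d0) mul1n muln_gcdl.
by rewrite !divnK ?dvdn_gcdl ?dvdn_gcdr.
Qed.

Lemma orbit_step_zero_orbit (f : {poly int}) (x0 : int) (i : nat) :
  orbit_term f 0 4 = orbit_term f 0 2 -> orbit_term f 0 2 != 0 ->
  orbit_step (orbit_term f 0 1) (orbit_term f 0 2) (orbit_term f 0 3)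
    (orbit_term f x0 i) (orbit_term f x0 i.+1).
Proof.
move=> u42 u2.
have oS x j : orbit_term f x j.+1 = f.[orbit_term f x j].
  by rewrite !orbit_termE.
have o0 : orbit_term f 0 0 = 0 by rewrite orbit_termE.
set x := orbit_term f x0 i; rewrite (oS x0 i) -/x.
have x_sub k := dvdz_sub_horner f x (orbit_term f 0 k).
apply/and5P; split.
- by have := x_sub 0%N; rewrite -(oS 0 0%N) o0 subr0.
- by have := x_sub 1%N; rewrite -(oS 0 1%N).
- by have := x_sub 2%N; rewrite -(oS 0 2%N).
- by have := x_sub 3%N; rewrite -(oS 0 3%N) u42.
apply/implyP => /eqP u31.
have := dvdz_mul_sub_horner f 0 (orbit_term f 0 2) x.
rewrite -(oS 0 2%N) u31 eq_sym subr0; apply=> //.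
by rewrite (oS 0 0%N) o0.
Qed.

(** * Coprimality and private primes of the reduced orbit *)

Theorem theorem3 (f : {poly int}) (x0 : int) :
  strictly_preperiodic f 0 ->
  wandering f x0 ->
  (forall m n : nat, m <> n ->
     coprimez (reduced_orbit f x0 m) (reduced_orbit f x0 n)) /\
  (forall n : nat, (3 <= n)%N ->
     exists p : nat, private_prime_factor (reduced_orbit f x0) n p).
Proof.
move=> [pre0 nper0] wx.
have dF : difference_dvd (horner f) := dvdz_sub_horner f.
have u0 k : (0 < k)%N -> iter k (horner f) 0 != 0.
  by move=> k0; apply/eqP => e; apply: nper0; exists k; rewrite ?orbit_termE.
have u_pre : exists m n, (0 < n)%N /\
    iter n (horner f) (iter m (horner f) 0) = iter m (horner f) 0.
  by case: pre0 => m [n n0]; rewrite !orbit_termE; exists m, n.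
have u_dvd := zero_orbit_dvd_u2 _ dF u_pre.
have x_neq0 n : orbit_term f x0 n != 0.
  apply/eqP; have := not_wandering_meets_zero _ _ n 0%N pre0 wx.
  by rewrite [orbit_term f 0 0]orbit_termE.
have ellE : `|ell f|%N = `|iter 2 (horner f) 0|%N.
  rewrite /ell /lcmz !orbit_termE absz_nat; apply/eqP.
  have := u_dvd 1%N isT; rewrite dvdzE => ab.
  by rewrite eqn_dvd dvdn_lcmr dvdn_lcm dvdnn andbT ab.
have absa n : `|reduced_orbit f x0 n|%N =
    (`|orbit_term f x0 n| %/ gcdn `|orbit_term f x0 n| `|ell f|)%N.
  set x := orbit_term f x0 n.
  have g0 : (0 < gcdn `|x| `|ell f|)%N by rewrite gcdn_gt0 absz_gt0 x_neq0.
  have /divzK/(congr1 absz) : (gcdz x (ell f) %| x)%Z := dvdz_gcdl _ _.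
  by rewrite abszM absz_nat => xE; rewrite -[X in (X %/ _)%N]xE mulnK.
have gcd_lt m n : (m < n)%N ->
    (gcdn `|orbit_term f x0 m| `|orbit_term f x0 n| %| `|ell f|)%N.
  move=> mn; rewrite ellE.
  have := difference_dvd_iter _ dF (n - m)%N (orbit_term f x0 m) 0.
  rewrite (_ : iter _ _ (orbit_term f x0 m) = orbit_term f x0 n); last first.
    by rewrite !orbit_termE -iterD subnK // ltnW.
  rewrite subr0 => d_mn.
  have k0 : (0 < n - m)%N by rewrite subn_gt0.
  apply: dvdn_trans (u_dvd _ k0).
  set d := gcdn _ _; rewrite -[d]/`|d%:Z|%N -dvdzE.
  rewrite -[X in (_ %| X)%Z](subKr (orbit_term f x0 n)) rpredB //.
    by rewrite /d dvdzE dvdn_gcdr.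
  by apply: dvdz_trans d_mn; rewrite /d dvdzE dvdn_gcdl.
have copr m n : m <> n -> coprimez (reduced_orbit f x0 m) (reduced_orbit f x0 n).
  move=> /eqP mn; rewrite coprimezE !absa; apply: coprime_div_gcd.
    by rewrite absz_gt0.
  by case: ltngtP mn => // [/gcd_lt|/gcd_lt] //; rewrite gcdnC.
split=> // n n3.
have a_gt0 m : (0 < `|reduced_orbit f x0 m|)%N.
  have x_gt0 : (0 < `|orbit_term f x0 m|)%N by rewrite absz_gt0.
  rewrite absa divn_gt0 ?gcdn_gt0 ?x_gt0 //.
  exact: dvdn_leq x_gt0 (dvdn_gcdl _ _).
have a_neq1 : `|reduced_orbit f x0 n|%N != 1%N.
  rewrite absa; apply/eqP => a1.
  (* A trivial quotient means that x_n equals its gcd with [ell f], up to sign. *)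
  have w_b : (orbit_term f x0 n %| orbit_term f 0 2)%Z.
    rewrite dvdzE (orbit_termE f 0) -ellE -[X in (X %| _)%N](divnK (dvdn_gcdl _ `|ell f|)).
    by rewrite a1 mul1n dvdn_gcdr.
  have out i k : (orbit_term f x0 i == orbit_term f 0 k) = false.
    by apply/eqP; exact: not_wandering_meets_zero.
  have out0 i : (orbit_term f x0 i == 0) = false by exact: negbTE.
  have inj i j : (orbit_term f x0 i == orbit_term f x0 j) = (i == j).
    exact: inj_eq (wandering_inj _ _ wx) i j.
  have step i : orbit_step (orbit_term f 0 1) (orbit_term f 0 2) (orbit_term f 0 3)
      (orbit_term f x0 i) (orbit_term f x0 i.+1).
    apply: orbit_step_zero_orbit; first by rewrite !orbit_termE zero_orbit_u4.
    by rewrite orbit_termE u0.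
  have abc : zero_orbit_type (orbit_term f 0 1) (orbit_term f 0 2) (orbit_term f 0 3).
    rewrite !orbit_termE; apply: zero_orbit_classification => // p q s.
    exact: dvdz_mul_sub_horner.
  (* The bound n >= 3 supplies the three predecessors of x_n that form the chain. *)
  case: n n3 w_b {a1} => [|[|[|n]]] // _ w_b.
  apply: (no_chain_into_divisor _ _ _ _ _ _ _ abc _ _ w_b _ _ _ _
    (step n.+2) (step n.+1) (step n));
    by rewrite ?inE ?negb_or ?out ?out0 ?inj ?orbit_termE ?u0 //; lia.
have a_gt1 : (1 < `|reduced_orbit f x0 n|)%N by rewrite ltn_neqAle eq_sym a_neq1 a_gt0.
move: (reduced_orbit f x0) copr a_gt1 => a copr a_gt1.
have pr := pdiv_prime a_gt1.
exists (pdiv `|a n|); split=> //; first by rewrite dvdzE pdiv_dvd.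
move=> m mn; rewrite dvdzE => dvd_m.
have := copr _ _ mn; rewrite coprimezE => /(coprime_dvdl dvd_m).
move/(coprime_dvdr (pdiv_dvd _)); rewrite /coprime gcdnn => /eqP p1.
by rewrite absz_nat in p1; rewrite p1 in pr.
Qed.
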